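(* Let $G_n$ be the $n$-cube (the hypercube graph) on $2^n$ vertices. Then the family $(G_n)$ belongs to the spectral class $\delta_1$, the Dirac measure supported at $1$.
   Context: For a simple graph $G=(V,E)$ with $N=|V|$ vertices, the normalized Laplacian acts on functions $f:V\to\mathbb{R}$ by $\Delta_G f(x)=f(x)-\frac{1}{d_x}\sum_{y\sim x}f(y)$, where $d_x$ is the degree of $x$. Its spectrum consists of $N$ eigenvalues (with multiplicity) $0=\lambda_0\le\cdots\le\lambda_{N-1}\le 2$. The associated probability measure on $[0,2]$ is $\mu(G)=\frac1N\sum_{i=0}^{N-1}\delta_{\lambda_i}$, where $\delta_a$ is the Dirac measure at $a$. A family $(G_n)$ of graphs belongs to the spectral class $\rho$, where $\rho$ is a Radon measure on $[0,2]$, if $\mu(G_n)$ converges weakly to $\rho$ as $n\to\infty$, i.e. $\int f\,d\mu(G_n)\to\int f\,d\rho$ for all continuous $f:[0,2]\to\mathbb{R}$. *)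

(* Defs.v *)
From HB Require Import structures.
From mathcomp Require Import all_boot all_order all_algebra.
From mathcomp Require Import all_classical all_reals all_analysis.
From mathcomp Require Import spectral complex lra.

Set Implicit Arguments.
Unset Strict Implicit.
Unset Printing Implicit Defensive.

Import Order.TTheory GRing.Theory Num.Theory.
Import numFieldNormedType.Exports.

Local Open Scope classical_set_scope.
Local Open Scope ring_scope.

Record sgraph := SGraph {
  vertex :> finType;
  adj : rel vertex;
  adj_sym : symmetric adj;
  adj_irr : irreflexive adj }.

Arguments adj {s} _ _.

Definition degree (G : sgraph) (x : G) : nat := #|[set y : G | adj x y]%SET|.

Section Hypercube.
Variable n : nat.

Definition cube_adj : rel {ffun 'I_n -> bool} :=
  fun x y => #|[set i | x i != y i]%SET| == 1%N.

Lemma cube_adj_sym : symmetric cube_adj.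
Proof.
move=> x y; rewrite /cube_adj; congr (_ == _).
by apply: eq_card => i; rewrite !inE eq_sym.
Qed.

Lemma cube_adj_irr : irreflexive cube_adj.
Proof.
by move=> x; rewrite /cube_adj eq_card0// => i; rewrite !inE eqxx.
Qed.

Definition hypercube : sgraph := SGraph cube_adj_sym cube_adj_irr.

End Hypercube.

Section Laplacian.
Variables (R : realType) (G : sgraph).

(* At an isolated vertex the convention 0^-1 = 0 gives laplacian f x = f x. *)
Definition laplacian (f : G -> R) (x : G) : R :=
  f x - (degree x)%:R^-1 * \sum_(y | adj x y) f y.

(* Column j is the image of the indicator function of the j-th vertex. *)
Definition laplacian_mx : 'M[R]_#|G| :=
  \matrix_(i, j) laplacian (fun y => (y == enum_val j)%:R) (enum_val i).

Lemma laplacian_mxE (f : G -> R) :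
  laplacian_mx *m \col_j f (enum_val j) = \col_i laplacian f (enum_val i).
Proof.
apply/colP => i; rewrite !mxE.
under eq_bigr => j _ do rewrite !mxE mulrBl.
rewrite sumrB; congr (_ - _).
  rewrite (bigD1 i)//= eqxx mul1r big1 ?addr0// => j ji.
  by rewrite (inj_eq enum_val_inj) eq_sym (negbTE ji) mul0r.
under eq_bigr do rewrite -mulrA.
rewrite -mulr_sumr; congr (_ * _).
under eq_bigr do rewrite mulr_suml.
rewrite exchange_big/=; apply: eq_bigr => y _.
rewrite (bigD1 (enum_rank y))//= enum_rankK eqxx mul1r big1 ?addr0// => j jy.
have -> : (y == enum_val j) = false; last by rewrite mul0r.
by apply/negbTE; apply: contra jy => /eqP ->; rewrite enum_valK.
Qed.

Lemma char_poly_similar (F : fieldType) n (P A : 'M[F]_n) : P \in unitmx ->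
  char_poly (invmx P *m A *m P) = char_poly A.
Proof.
move=> Pu; rewrite /char_poly /char_poly_mx.
have Pu' : map_mx polyC (invmx P) *m map_mx polyC P = 1%:M.
  by rewrite -map_mxM mulVmx// map_mx1.
have -> : 'X%:M - map_mx polyC (invmx P *m A *m P) =
   map_mx polyC (invmx P) *m ('X%:M - map_mx polyC A) *m map_mx polyC P.
  rewrite mulmxBr mulmxBl !map_mxM; congr (_ - _).
  by rewrite scalar_mxC -mulmxA Pu' mulmx1.
by rewrite !det_mulmx mulrAC -det_mulmx Pu' det1 mul1r.
Qed.

Lemma symmetric_split n (A : 'M[R]_n) : A^T = A ->
  exists s : n.-tuple R, char_poly A = \prod_(a <- s) ('X - a%:P).
Proof.
move=> As; pose B := map_mx (real_complex R) A.
have Bh : B \is hermsymmx.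
  apply: realsym_hermsym.
    apply/is_hermitianmxP; rewrite expr0 scale1r; apply/matrixP => i j.
    by rewrite !mxE -[in LHS]As mxE.
  by apply/mxOverP => i j; rewrite mxE complex_real.
have /hermitian_normalmx/orthomx_spectralP := Bh.
have := hermitian_spectral_diag_real Bh.
have := spectral_unit B.
move: (spectralmx B) (spectral_diag B) => P d Pu dr BE.
exists [tuple complex.Re (d 0 i) | i < n].
apply: (map_poly_inj (real_complex R)).
rewrite map_char_poly -/B BE char_poly_similar// char_poly_trig; last first.
  exact: diag_mx_is_trig.
rewrite big_map big_enum/= rmorph_prod/=; apply: eq_bigr => i _.
rewrite rmorphB/= map_polyX map_polyC/= mxE eqxx mulr1n; congr (_ - _%:P).
by rewrite RRe_real//; exact: (mxOverP dr).
Qed.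

Lemma laplacian_mx_split : exists s : #|G|.-tuple R,
  sorted <=%R s /\ char_poly laplacian_mx = \prod_(a <- s) ('X - a%:P).
Proof.
pose w (x : G) : R := if degree x == 0%N then 1 else Num.sqrt (degree x)%:R.
have w0 (x : G) : w x != 0.
  rewrite /w; have [_|d0] := eqVneq (degree x) 0%N; first exact: oner_neq0.
  by rewrite sqrtr_eq0 -ltNge ltr0n lt0n.
have w2 x : degree x != 0%N -> (degree x)%:R^-1 * w x = (w x)^-1.
  move=> d0; rewrite /w (negbTE d0) -{1}[_%:R]sqr_sqrtr// expr2 invfM.
  rewrite -mulrA mulVf ?mulr1//.
  by rewrite sqrtr_eq0 -ltNge ltr0n lt0n.
have dn0 (x y : G) : adj x y -> degree x != 0%N.
  by move=> xy; rewrite -lt0n; apply/card_gt0P; exists y; rewrite inE.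
have LE i j : laplacian_mx i j = (enum_val i == enum_val j)%:R -
    (degree (enum_val i))%:R^-1 * (adj (enum_val i) (enum_val j))%:R.
  rewrite mxE; congr (_ - _ * _).
  case: (boolP (adj _ _)) => [aij|naij].
    rewrite (bigD1 (enum_val j))//= eqxx big1 ?addr0// => y /andP[_ /negbTE->].
    by [].
  rewrite big1// => y ay; case: eqP => // yj.
  by rewrite -yj ay in naij.
pose P : 'M[R]_#|G| := diag_mx (\row_i w (enum_val i)).
pose Q : 'M[R]_#|G| := diag_mx (\row_i (w (enum_val i))^-1).
have PQ : P *m Q = 1%:M.
  apply/matrixP => i j; rewrite mul_diag_mx !mxE.
  by case: eqP => [->|_]; rewrite ?mulr0n ?mulr0// mulr1n divff.
have [Pu QE] : P \in unitmx /\ Q = invmx P.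
  have Pu := (mulmx1_unit PQ).1; split => //.
  by rewrite -[LHS](mulKmx Pu) PQ mulmx1.
have [|s sE] := @symmetric_split _ (P *m laplacian_mx *m Q).
  have SE i j : (P *m laplacian_mx *m Q) i j =
      w (enum_val i) * laplacian_mx i j * (w (enum_val j))^-1.
    by rewrite mul_diag_mx mul_mx_diag ![in LHS]mxE [in RHS]mxE.
  apply/matrixP => i j; rewrite mxE !SE !LE adj_sym (eq_sym (enum_val i)).
  set x := enum_val j; set y := enum_val i.
  have [->//|xy] := eqVneq x y; rewrite !sub0r.
  have [yx_|_] := boolP (adj y x); last by rewrite !mulr0 oppr0 !mulr0 !mul0r.
  have xy_ : adj x y by rewrite adj_sym.
  rewrite !mulr1 !mulrN !mulNr; congr (- _).
  rewrite [w x * _]mulrC [w y * _]mulrC (w2 _ (dn0 _ _ xy_)).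
  by rewrite (w2 _ (dn0 _ _ yx_)) mulrC.
exists (sort_tuple <=%R s); split; first exact: sort_le_sorted.
rewrite (perm_big (tval s)) ?perm_sort//.
rewrite -sE -(char_poly_similar (P *m laplacian_mx *m Q) Pu) QE.
by rewrite !mulmxA mulVmx// mul1mx mulmxKV.
Qed.

(* The eigenvalues, listed with their algebraic multiplicities. *)
Definition spectrum : #|G|.-tuple R := sval (cid laplacian_mx_split).

Lemma spectrum_sorted : sorted <=%R spectrum.
Proof. by rewrite /spectrum; case: cid => s []. Qed.

Lemma spectrum_char_poly :
  char_poly laplacian_mx = \prod_(a <- spectrum) ('X - a%:P).
Proof. by rewrite /spectrum; case: cid => s []. Qed.

Lemma spectrum_itv a : a \in (spectrum : seq R) -> 0 <= a <= 2.
Proof.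
rewrite -root_prod_XsubC -spectrum_char_poly.
have -> : char_poly laplacian_mx = char_poly laplacian_mx^T.
  rewrite /char_poly -det_tr /char_poly_mx; congr (\det _).
  by rewrite linearB/= tr_scalar_mx map_trmx.
rewrite -eigenvalue_root_char => /eigenvalueP[v vL v0].
pose f (x : G) := v 0 (enum_rank x).
have fE x : laplacian f x = a * f x.
  have := laplacian_mxE f.
  have -> : \col_j f (enum_val j) = v^T.
    by apply/colP => j; rewrite !mxE /f enum_valK.
  rewrite -[laplacian_mx]trmxK -trmx_mul vL => /colP/(_ (enum_rank x)).
  by rewrite !mxE enum_rankK => <-.
have [i vi0] : exists i, v 0 i != 0.
  by apply/existsP; rewrite -negb_forall; apply: contra v0 => /forallP v0;
    apply/eqP/rowP => i; rewrite mxE; apply/eqP.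
pose x := [arg max_(y > enum_val i) `|f y|]%O.
have xmax y : `|f y| <= `|f x|.
  by rewrite /x; case: arg_maxP => //= z _; apply.
have fx0 : 0 < `|f x|.
  by apply: lt_le_trans (xmax (enum_val i)); rewrite /f enum_valK normr_gt0.
have : `|1 - a| * `|f x| <= `|f x|.
  rewrite -normrM mulrBl mul1r -fE /laplacian opprB addrC subrK normrM.
  have [d0|d0] := eqVneq (degree x) 0%N.
    by rewrite d0 invr0 normr0 mul0r.
  rewrite normfV normr_nat mulrC ler_pdivrMr ?ltr0n ?lt0n//.
  apply: le_trans (ler_norm_sum _ _ _) _.
  apply: (@le_trans _ _ (\sum_(y | adj x y) `|f x|)); first exact: ler_sum.
  rewrite sumr_const mulr_natr /degree.
  by rewrite (@eq_card _ (adj x) (mem [set y | adj x y]%SET))// => y; rewrite !inE.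
rewrite ger_pMl// ler_norml => /andP[h1 h2].
by apply/andP; split; lra.
Qed.

(* A measure on [0, 2] is represented by a measure on the real line that is
   null outside [0, 2], which is the case here by spectrum_itv. *)
Definition spectral_measure : {measure set (measurableTypeR R) -> \bar R} :=
  mscale (#|G|%:R^-1)%:nng
    (msum (fun i => dirac (spectrum`_i : measurableTypeR R)) #|G|).

End Laplacian.

Arguments spectrum : clear implicits.
Arguments spectral_measure : clear implicits.

(* On the compact set [0, 2], Radon measures are the finite Borel measures. *)
Definition in_spectral_class (R : realType) (G : nat -> sgraph)
    (rho : {finite_measure set (measurableTypeR R) -> \bar R}) : Prop :=
  let I02 : set R := `[0, 2]%classic in
  rho (~` I02) = 0%E /\
  forall f : R -> R, {within I02, continuous f} ->
    (\int[spectral_measure R (G n)]_(x in I02) (f x)%:E)%E @[n --> \oo]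
      --> (\int[rho]_(x in I02) (f x)%:E)%E.

(* Main.v *)
Require Import Defs.
From mathcomp Require Import all_boot all_order all_algebra.
From mathcomp Require Import all_classical all_reals all_analysis.
From mathcomp Require Import measurable_realfun ring lra.

(** The explicit spectrum of the cube is never computed: two moments suffice.
    Write A for the transition matrix of the simple random walk on a finite
    graph G, so that the Laplacian is 1 - A. Since the eigenvalues a are the
    roots of a split characteristic polynomial, the sum of the (a - 1)^2 is the
    trace of A^2, that is, the sum over ordered pairs of adjacent vertices of
    1 / (d_x d_y) ([spectrum_variance]). If all degrees are at least d > 0, this
    is at most |G| / d ([spectrum_variance_le]): the mean square distance from
    the spectral measure to the point 1 is at most 1 / d.

    Chebyshev's argument concludes. A continuous f on [0, 2] satisfies
    |f x - f 1| <= e + K (x - 1)^2 for every e > 0 and some K depending on e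
    ([continuous_quadratic_bound]), so the integral of f against the spectral
    measure is within e + K / d of f 1. Hence every sequence of graphs whose
    minimum degree tends to infinity belongs to the spectral class of the Dirac
    measure at 1 ([spectral_class_min_degree]); the n-cube is n-regular. *)

Set Implicit Arguments.
Unset Strict Implicit.
Unset Printing Implicit Defensive.

Import Order.TTheory GRing.Theory Num.Theory.
Import numFieldNormedType.Exports.

Local Open Scope classical_set_scope.
Local Open Scope ring_scope.

Section SplitCharPoly.
Variable K : comNzRingType.

(** For the empty matrix the coefficient of index n - 1 is not the trace, so
    n = 0 is a separate case. *)
Lemma mxtrace_split n (A : 'M[K]_n) (s : n.-tuple K) :
  char_poly A = \prod_(a <- s) ('X - a%:P) -> \tr A = \sum_(a <- s) a.
Proof.
case: n => [|n] in A s * => sE.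
  by rewrite (tuple0 s) big_nil /mxtrace big_ord0.
apply: oppr_inj; rewrite -char_poly_trace// sE.
have := @coefPn_prod_XsubC _ s; rewrite size_tuple; exact.
Qed.

Lemma comp_char_poly n (A : 'M[K]_n) (p : {poly K}) :
  char_poly A \Po p = \det (p%:M - map_mx polyC A).
Proof.
rewrite /char_poly -det_map_mx; congr (\det _).
apply/matrixP => i j; rewrite !mxE rmorphB/= comp_polyC.
by case: (_ == _); rewrite ?mulr1n ?mulr0n ?comp_polyX ?comp_poly0.
Qed.

(** From X^2 - A^2 = (X - A)(X + A), the characteristic polynomial of A^2
    evaluated at X^2 is the product of the (X - a)(X + a) = X^2 - a^2. The
    factor det (X + A) is, up to sign, the characteristic polynomial of A
    evaluated at -X. This works over any commutative ring, with no
    diagonalization. *)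
Lemma char_poly_sqr n (A : 'M[K]_n) (s : n.-tuple K) :
  char_poly A = \prod_(a <- s) ('X - a%:P) ->
  char_poly (A *m A) = \prod_(a <- s) ('X - (a ^+ 2)%:P).
Proof.
move=> sE.
have compX2_inj : injective (fun p : {poly K} => p \Po 'X^2).
  move=> p q /polyP pq; apply/polyP => i.
  by have := pq (i * 2)%N; rewrite !coef_comp_poly_Xn// dvdn_mull// mulnK.
apply: compX2_inj => /=.
have detD : \det ('X%:M + map_mx polyC A) = \prod_(a <- s) ('X + a%:P).
  have -> : 'X%:M + map_mx polyC A = -1 *: ((- 'X)%:M - map_mx polyC A).
    by rewrite scaleN1r opprB raddfN/= opprK addrC.
  rewrite detZ -comp_char_poly sE rmorph_prod/= -[X in _ ^+ X](size_tuple s).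
  elim: (tval s) => [|a t IHt]; first by rewrite !big_nil mulr1.
  rewrite !big_cons -IHt rmorphB/= comp_polyX comp_polyC exprS.
  by rewrite mulrACA mulN1r opprB opprK addrC.
rewrite comp_char_poly.
have -> : ('X^2)%:M - map_mx polyC (A *m A) =
    ('X%:M - map_mx polyC A) *m ('X%:M + map_mx polyC A).
  rewrite map_mxM mulmxBl !mulmxDr -scalar_mxM -expr2 opprD addrA.
  by rewrite scalar_mxC addrK.
rewrite det_mulmx detD -/(char_poly A) sE.
rewrite -big_split rmorph_prod; apply: eq_bigr => a _ /=.
by rewrite rmorphB/= comp_polyX comp_polyC -subr_sqr rmorphXn.
Qed.

End SplitCharPoly.

Lemma measurable_within_continuous (R : realType) (a b : R) (f : R -> R) :
  {within `[a, b], continuous f} ->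
  measurable (`[a, b]%classic : set (measurableTypeR R)) /\
  measurable_fun (`[a, b]%classic : set (measurableTypeR R))
    (fun x : measurableTypeR R => (f x)%:E).
Proof.
move=> cf; split; first exact: measurable_itv.
apply/measurable_EFinP.
exact: (subspace_continuous_measurable_fun (measurable_itv _) cf).
Qed.

Section Variance.
Variables (R : realType) (G : sgraph).

Lemma laplacian_mx_coef (i j : 'I_#|G|) :
  laplacian_mx R G i j = (i == j)%:R -
    (degree (enum_val i))%:R^-1 * (adj (enum_val i) (enum_val j))%:R.
Proof.
rewrite mxE /laplacian (inj_eq enum_val_inj); congr (_ - _ * _).
rewrite big_mkcond (bigD1 (enum_val j))//= eqxx big1 => [|y /negbTE ->].
  by rewrite addr0; case: adj.
by case: adj.
Qed.

(** The left-hand side is tr L^2 - 2 tr L + |G|, where L has diagonal 1 because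
    there are no loops. The i-th diagonal entry of L^2 is 1, from the diagonal
    of L, plus the sum of 1 / (d_x d_y) over the neighbours y of the i-th
    vertex x. *)
Lemma spectrum_variance :
  \sum_(a <- spectrum R G) (a - 1) ^+ 2 =
  \sum_(x : G) \sum_(y | adj x y) (degree x)%:R^-1 * (degree y)%:R^-1.
Proof.
have sE := spectrum_char_poly R G.
have tr1 := mxtrace_split sE.
have tr2 : \tr (laplacian_mx R G *m laplacian_mx R G) =
    \sum_(a <- spectrum R G) a ^+ 2.
  have := @mxtrace_split _ _ _ [tuple of map (fun a => a ^+ 2) (spectrum R G)].
  by rewrite !big_map; apply; exact: char_poly_sqr.
have -> : \sum_(a <- spectrum R G) (a - 1) ^+ 2 =
    \tr (laplacian_mx R G *m laplacian_mx R G) - 2 * \tr (laplacian_mx R G)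
    + #|G|%:R.
  have -> : #|G|%:R = \sum_(a <- spectrum R G) 1 :> R.
    by rewrite big_const_seq count_predT size_tuple iter_addr_0.
  rewrite tr1 tr2 mulr_sumr -sumrB -big_split; apply: eq_bigr => a _ /=; ring.
have -> : \tr (laplacian_mx R G) = #|G|%:R.
  rewrite /mxtrace -[X in _ = X%:R]card_ord -sumr_const.
  apply: eq_bigr => i _.
  by rewrite laplacian_mx_coef eqxx adj_irr mulr0 subr0.
rewrite /mxtrace [RHS](reindex _ (onW_bij _ (@enum_val_bij G)))/=.
suff rowE i : (laplacian_mx R G *m laplacian_mx R G) i i = 1 +
    \sum_(y | adj (enum_val i) y)
      (degree (enum_val i))%:R^-1 * (degree y)%:R^-1.
  rewrite (eq_bigr _ (fun i _ => rowE i)) big_split/= sumr_const card_ord; ring.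
rewrite mxE [in RHS](big_mkcond (adj _))/=.
rewrite [in RHS](reindex _ (onW_bij _ (@enum_val_bij G)))/=.
have oneE : 1 = \sum_(j < #|G|) (i == j)%:R :> R.
  by rewrite (bigD1 i)//= eqxx big1 ?addr0// => j; rewrite eq_sym => /negbTE ->.
rewrite [X in X + _]oneE -big_split; apply: eq_bigr => j _ /=.
rewrite !laplacian_mx_coef (adj_sym (enum_val j)) (eq_sym j).
have [<-|ij] := eqVneq i j.
  by rewrite adj_irr !mulr0 subr0 mulr1 addr0.
by case: adj; rewrite /= !(mulr0, mulr1, sub0r, add0r, oppr0)// mulrNN.
Qed.

Lemma spectrum_variance_le d : (0 < d)%N -> (forall x : G, d <= degree x)%N ->
  \sum_(a <- spectrum R G) (a - 1) ^+ 2 <= #|G|%:R / d%:R.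
Proof.
move=> d0 dG; rewrite spectrum_variance mulr_natl -sumr_const.
apply: ler_sum => x _; have dx0 : (0 < degree x)%N := leq_trans d0 (dG x).
apply: (@le_trans _ _ (\sum_(y | adj x y) (degree x)%:R^-1 * d%:R^-1)).
  apply: ler_sum => y _; rewrite ler_wpM2l ?invr_ge0//.
  by rewrite lef_pV2 ?posrE ?ltr0n ?ler_nat// (leq_trans d0).
have -> : \sum_(y | adj x y) (degree x)%:R^-1 * d%:R^-1 =
    \sum_(y in [set y | adj x y]%SET) (degree x)%:R^-1 * d%:R^-1 :> R.
  by apply: eq_bigl => y; rewrite inE.
rewrite sumr_const -/(degree x) -[_ *+ _]mulr_natl mulrA divff ?mul1r//.
by rewrite pnatr_eq0 -lt0n.
Qed.

(** For nonnegative functions the integral is linear in the measure without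
    any integrability condition, hence the splitting of f into its positive and
    negative parts. *)
Lemma integral_spectral_measure (f : R -> R) :
  {within `[0, 2], continuous f} ->
  (\int[spectral_measure R G]_(x in `[0%R, 2%R]) (f x)%:E)%E =
  (#|G|%:R^-1 * \sum_(a <- spectrum R G) f a)%:E.
Proof.
move=> cf.
have [mI mf] := measurable_within_continuous cf.
have ge0_intE (g : measurableTypeR R -> \bar R) :
    (forall x, 0 <= g x)%E ->
    measurable_fun (`[0%R, 2%R]%classic : set (measurableTypeR R)) g ->
    (\int[spectral_measure R G]_(x in `[0%R, 2%R]) g x =
     (#|G|%:R^-1)%:E * \sum_(a <- spectrum R G) g a)%E.
  move=> g0 mg.
  rewrite ge0_integral_mscale//= ge0_integral_measure_sum//.
  rewrite [in RHS](big_nth 0) size_tuple big_mkord; congr (_ * _)%E.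
  apply: eq_bigr => i _; rewrite integral_dirac// diracE mem_set ?mul1e//=.
  by rewrite in_itv/= (@spectrum_itv R G)// mem_nth// size_tuple.
rewrite integralE !ge0_intE//; last 2 first.
- exact: measurable_funeneg.
- exact: measurable_funepos.
rewrite funerpos funerneg !sumEFin -!EFinM -EFinB -mulrBr -sumrB.
congr (_ * _)%:E; apply: eq_bigr => a _.
by rewrite -[in RHS](funrposBneg f).
Qed.

End Variance.

Section WeakConvergence.
Variable R : realType.

(** Near c continuity gives the bound e. At distance at least d from c the
    quadratic term takes over: if |f| <= B on the segment, then
    K = 2 B / d^2 is large enough. *)
Lemma continuous_quadratic_bound (a b c : R) (f : R -> R) (e : R) :
  c \in `[a, b] -> {within `[a, b], continuous f} -> 0 < e ->
  exists2 K, 0 <= K & forall x, x \in `[a, b] ->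
    `|f x - f c| <= e + K * (x - c) ^+ 2.
Proof.
move=> cab cf e0.
have [M [_ fM]] : bounded_set (f @` `[a, b]).
  exact/compact_bounded/(continuous_compact cf)/segment_compact.
have {}fM x : x \in `[a, b] -> `|f x| <= `|M| + 1.
  move=> xab; apply: (fM (`|M| + 1)).
    by rewrite (le_lt_trans (ler_norm M))// ltrDl.
  by exists x.
have /(_ _ cab) := (subspace_continuousP _ f).1 cf.
move=> /cvgrPdist_le/(_ e e0); rewrite near_withinE => -[d /= d0 fd].
pose K := 2 * (`|M| + 1) / d ^+ 2.
have M0 : 0 <= `|M| by [].
have K0 : 0 <= K by rewrite divr_ge0 ?sqr_ge0//; lra.
exists K => // x xab; have [xd|dx] := ltP `|c - x| d.
  by rewrite distrC (le_trans (fd x xd xab))// lerDl mulr_ge0// sqr_ge0.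
apply: (@le_trans _ _ (2 * (`|M| + 1))).
  rewrite (le_trans (ler_normB _ _))//.
  by have := fM x xab; have := fM c cab; lra.
rewrite -[leLHS]add0r lerD//; first exact: ltW.
rewrite /K mulrAC ler_pdivlMr ?exprn_gt0// ler_wpM2l//.
rewrite -[leRHS]real_normK ?num_real// distrC lerXn2r// ?nnegrE//.
exact: ltW.
Qed.

(** The spectral measures concentrate at 1 in mean square, at rate 1 / d n. *)
Theorem spectral_class_min_degree (G : nat -> sgraph) (d : nat -> nat) :
  (forall n, 0 < #|G n|)%N -> (forall n (x : G n), d n <= degree x)%N ->
  d @ \oo --> \oo ->
  in_spectral_class G (dirac (1%R : measurableTypeR R)).
Proof.
move=> G0 dG doo; split.
  rewrite /= diracE memNset//= => /(_ _)[]; rewrite in_itv/=; lra.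
move=> f cf.
have [mI mf] := measurable_within_continuous cf.
have I1 : 1 \in `[0, 2 : R] by rewrite in_itv/=; lra.
rewrite integral_dirac// diracE mem_set// mul1e.
under eq_fun do rewrite integral_spectral_measure//.
apply: cvg_EFin; first exact: nearW.
apply/cvgrPdist_le => e e0.
have [|K K0 fK] := continuous_quadratic_bound I1 cf (_ : 0 < e / 2); first lra.
near=> n.
have d0 : (0 < d n)%N by near: n; exact: (doo _ (nbhs_infty_gt 0)).
have N0 : 0 < #|G n|%:R :> R by rewrite ltr0n.
have Kd : K / (d n)%:R <= e / 2.
  have e20 : 0 < e / 2 by lra.
  rewrite ler_pdivrMr ?ltr0n// mulrC -ler_pdivrMr//.
  apply: (le_trans (ltW (truncnS_gt _))); rewrite ler_nat.
  by near: n; exact: (doo _ (nbhs_infty_ge _)).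
have sum_cst (g : R) : \sum_(a <- spectrum R (G n)) g = #|G n|%:R * g.
  by rewrite big_const_seq count_predT size_tuple iter_addr_0 mulr_natl.
have -> : f 1 = #|G n|%:R^-1 * \sum_(a <- spectrum R (G n)) f 1.
  by rewrite sum_cst mulKf// gt_eqF.
rewrite -mulrBr -sumrB normrM ger0_norm ?invr_ge0//.
rewrite ler_pdivrMl// (le_trans (ler_norm_sum _ _ _))//.
apply: (@le_trans _ _
  (\sum_(a <- spectrum R (G n)) (e / 2 + K * (a - 1) ^+ 2))).
  rewrite big_seq [leRHS]big_seq; apply: ler_sum => a aG.
  by rewrite distrC fK// in_itv/= (spectrum_itv aG).
rewrite big_split/= sum_cst -[X in _ + X]mulr_sumr.
rewrite [e in leRHS]splitr mulrDr lerD2l.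
rewrite (le_trans (ler_wpM2l K0 (spectrum_variance_le R d0 (dG n))))//.
by rewrite mulrCA ler_wpM2l.
Unshelve. all: by end_near.
Qed.

End WeakConvergence.

(** The neighbours of x are the images of x under the n coordinate flips. *)
Lemma degree_hypercube n (x : hypercube n) : degree x = n.
Proof.
pose flip (i : 'I_n) : hypercube n := [ffun j => x j (+) (j == i)].
have flip_inj : injective flip.
  by move=> i j /ffunP/(_ i); rewrite !ffunE eqxx => /addbI/esym/eqP.
rewrite /degree -[RHS]card_ord -(card_imset _ flip_inj).
apply: eq_card => y; rewrite !inE /= /cube_adj.
apply/cards1P/imsetP => [[i xyi]|[i _ ->]]; exists i => //.
  apply/ffunP => j; rewrite ffunE; move/setP/(_ j): xyi; rewrite !inE => <-.
  by case: (x j); case: (y j).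
apply/setP => j; rewrite !inE ffunE.
by case: (x j); case: (j == i).
Qed.

Theorem proposition2p3 (R : realType) :
  in_spectral_class hypercube (dirac (1%R : measurableTypeR R)).
Proof.
apply: (@spectral_class_min_degree R hypercube id) => [n|n x|//].
- by apply/card_gt0P; exists [ffun=> false].
- by rewrite degree_hypercube.
Qed.
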